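(* Let $(\Psi_u,\Psi_l,\mathcal{S},\mathcal{T},\epsilon)$ be a solution of the SOS program (P) (given in the context) for a fixed degree $d$, and let $V_u=-\lambda\log\Psi_l$. For all $x\in\Omega$, $V_u$ is an upper bound of $V^*$ such that $$0\le V_u-V^*\le-\lambda\log\left(1-\min\left\{1,\frac{\epsilon}{\eta}\right\}\right),$$ where $\eta=e^{-\|V^*\|_\infty/\lambda}$.
   Context: Setting. $\Omega=\{x\in\mathbb{R}^n: g_i(x)\ge 0,\ i=1,\dots,k\}$ with $g_i\in\mathbb{R}[x]$ is a compact basic closed semialgebraic set, $0\in\Omega$, and $\partial\Omega=\{x:\prod_{i=1}^m h_i(x)=0\}$, $h_i\in\mathbb{R}[x]$. The dynamics are $dx_t=(f(x_t)+G(x_t)u_t)\,dt+B(x_t)\,d\omega_t$ with $f,G,B$ having real polynomial entries, $f(0)=0$, $G(0)=0$, $B(0)=0$, and $\omega_t$ a multidimensional Brownian motion with covariance $\Sigma_\epsilon$. The cost is $J(x,u)=\mathbb{E}_{\omega_t}[\phi(x_T)+\int_0^T q(x_t)+\frac12u_t^TRu_t\,dt]$, where $T$ is the first time the state reaches the boundary of the domain or the origin, $R$ is symmetric positive definite, and $\phi,q$ are nonnegative polynomials, positive definite on $\Omega$ (zero at $0$, positive on $\Omega\setminus\{0\}$). The origin is treated as part of the boundary on which boundary data are imposed: $\phi(0)=0$, and $\phi>0$ on $\partial\Omega\setminus\{0\}$. There is $\lambda>0$ with $\lambda G R^{-1}G^T=B\Sigma_\epsilon B^T=:\Sigma(x)=\Sigma_t$.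 Notation. $\mathcal{L}(\Psi)=f^T\nabla_x\Psi+\frac12\mathrm{Tr}((\nabla_{xx}\Psi)\Sigma)$; $\psi=e^{-\phi/\lambda}$ on $\partial\Omega$. It is assumed that $0=-\frac1\lambda q\Psi+\mathcal{L}(\Psi)$ on $\Omega$, $\Psi=\psi$ on $\partial\Omega$, has a unique nontrivial viscosity solution $\Psi^*$, and that the HJB equation $0=q+(\nabla_xV)^Tf-\frac12(\nabla_xV)^TGR^{-1}G^T\nabla_xV+\frac12\mathrm{Tr}((\nabla_{xx}V)B\Sigma_\epsilon B^T)$ on $\Omega$, $V=\phi$ on $\partial\Omega$, has a unique nontrivial viscosity solution $V^*$, the value function $V^*=\min_uJ$; they satisfy $V^*=-\lambda\log\Psi^*$. $\|f\|_\infty=\sup_{x\in\Omega}|f(x)|$. $\mathbb{S}[x]$ is the set of sums of squares of real polynomials. $\Psi_l$ is understood to be positive where its logarithm is taken, and $-\log 0=+\infty$. Operators. For a set $\{g_1\ge0,\dots,g_k\ge0\}=\Omega$ and $\mathcal{S}=\{s_\nu\in\mathbb{S}[x]:\nu\in\{0,1\}^k\}$, $\mathcal{D}(\Omega,\mathcal{S})=\sum_{\nu}s_\nu g_1^{\nu_1}\cdots g_k^{\nu_k}$. For a polynomial $p$ and $\mathcal{T}=\{t_1,\dots,t_m\}\subset\mathbb{R}[x]$, $\mathcal{B}(p,\partial\Omega,\mathcal{T})=\{p-t_ih_i:i=1,\dots,m\}$; $\mathcal{B}(\cdot)\in\mathbb{S}[x]$ means every element is in $\mathbb{S}[x]$ ($\psi$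 being represented by a polynomial on $\partial\Omega$ when $\mathcal{B}$ is applied). SOS program (P): minimize $\epsilon$ over polynomials $\Psi_l,\Psi_u$, and $\mathcal{S}=(\mathcal{S}_1,\dots,\mathcal{S}_5)$ (sets of SOS polynomials), $\mathcal{T}=(\mathcal{T}_1,\mathcal{T}_2,\mathcal{T}_3)$ (sets of polynomials), all of degree at most $d$, subject to: $-\frac1\lambda q\Psi_l+\mathcal{L}(\Psi_l)-\mathcal{D}(\Omega,\mathcal{S}_1)\in\mathbb{S}[x]$; $\frac1\lambda q\Psi_u-\mathcal{L}(\Psi_u)-\mathcal{D}(\Omega,\mathcal{S}_2)\in\mathbb{S}[x]$; $\epsilon-(\Psi_u-\Psi_l)-\mathcal{D}(\Omega,\mathcal{S}_3)\in\mathbb{S}[x]$; $\mathcal{B}(\Psi_l,\partial\Omega,\mathcal{T}_1)\in\mathbb{S}[x]$; $\mathcal{B}(\psi-\Psi_l,\partial\Omega,\mathcal{T}_2)\in\mathbb{S}[x]$; $\mathcal{B}(\Psi_u-\psi,\partial\Omega,\mathcal{T}_3)\in\mathbb{S}[x]$; for each coordinate $x^i$: $-\partial_{x^i}\Psi_l-\mathcal{D}(\Omega\cap\{x^i\ge0\},\mathcal{S}_4)\in\mathbb{S}[x]$ and $\partial_{x^i}\Psi_l-\mathcal{D}(\Omega\cap\{-x^i\ge0\},\mathcal{S}_5)\in\mathbb{S}[x]$; $\Psi_l(0)=1$. *)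

(* Defs.v *)
From HB Require Import structures.
From mathcomp Require Import all_boot all_order all_algebra.
From mathcomp Require Import all_classical all_reals all_analysis.
(* Only canonical structures: the notations of mpoly clash with those of
   mathcomp-analysis. *)
From mathcomp Require Import (canonicals) mpoly.

Set Implicit Arguments.
Unset Strict Implicit.
Unset Printing Implicit Defensive.

Import Order.TTheory GRing.Theory Num.Theory.
Import numFieldNormedType.Exports.

Local Open Scope classical_set_scope.
Local Open Scope ring_scope.

Notation pol R n := (mpoly.mpoly n R) (only parsing).

Section Polynomials.
Context {R : realType} {n : nat}.
Implicit Types p : pol R n.

Definition pev p (x : 'cV[R]_n) : R := mpoly.meval (fun i => x i 0) p.

Definition pevmx a b (A : 'M[pol R n]_(a, b)) (x : 'cV[R]_n) : 'M[R]_(a, b) :=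
  map_mx (fun p => pev p x) A.

Definition deg_le (d : nat) p : Prop :=
  forall mm : mpoly.multinom n, mpoly.mcoeff mm p != 0 -> (mpoly.mdeg mm <= d)%N.

Definition sos p : Prop := exists s : seq (pol R n), p = \sum_(a <- s) a ^+ 2.

Definition pvar (i : 'I_n) : pol R n := mpoly.mpolyX R (mpoly.mnm1 i).

End Polynomials.

Definition dotp {R : realType} {n} (u v : 'cV[R]_n) : R := (u^T *m v) 0 0.

Record problem (R : realType) (n p r k m : nat) := Problem {
  pb_g : 'I_k -> pol R n;
  pb_h : 'I_m -> pol R n;
  pb_f : 'cV[pol R n]_n;
  pb_G : 'M[pol R n]_(n, p);
  pb_B : 'M[pol R n]_(n, r);
  pb_Sig : 'M[R]_r;           (* covariance of the noise *)
  pb_R : 'M[R]_p;             (* control weight *)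
  pb_phi : pol R n;
  pb_q : pol R n
}.

Section Domain.
Context {R : realType} {n p r k m : nat} (pb : problem R n p r k m).

Definition Omega : set 'cV[R]_n := [set x | forall i, 0 <= pev (pb_g pb i) x].

(* The topological boundary together with the origin: the origin carries
   boundary data as well. *)
Definition bndOmega : set 'cV[R]_n := (closure Omega `\` Omega°) `|` [set 0].

Definition sup_norm (V : 'cV[R]_n -> R) : R := sup [set `|V x| | x in Omega].

End Domain.

Section Viscosity.
Context {R : realType} {n : nat}.
Implicit Types (V : 'cV[R]_n -> R) (x y v : 'cV[R]_n) (X : 'M[R]_n).

Definition quad V x v X y : R :=
  V x + dotp v (y - x) + 2^-1 * dotp (y - x) (X *m (y - x)).

(* (v, X) \in J^{2,+} V(x) *)
Definition superjet V x v X : Prop :=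
  X^T = X /\ forall e, 0 < e ->
    \forall y \near x, V y <= quad V x v X y + e * dotp (y - x) (y - x).

(* (v, X) \in J^{2,-} V(x) *)
Definition subjet V x v X : Prop :=
  X^T = X /\ forall e, 0 < e ->
    \forall y \near x, quad V x v X y - e * dotp (y - x) (y - x) <= V y.

(* Sign convention: the equation is F(x, V, DV, D^2V) = 0 with F nonincreasing
   in its matrix argument.  A viscosity solution is both upper and lower
   semicontinuous, i.e. continuous, on the closed domain D; the equation is
   imposed on D `\` bD and the Dirichlet data b on bD. *)
Definition viscosity_solution (D bD : set 'cV[R]_n)
    (F : 'cV[R]_n -> R -> 'cV[R]_n -> 'M[R]_n -> R)
    (b : 'cV[R]_n -> R) (V : 'cV[R]_n -> R) : Prop :=
  [/\ {within D, continuous V},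
      forall x v X, (D `\` bD) x -> superjet V x v X -> F x (V x) v X <= 0,
      forall x v X, (D `\` bD) x -> subjet V x v X -> 0 <= F x (V x) v X &
      forall x, bD x -> V x = b x].

Definition nontrivial_on (D : set 'cV[R]_n) V : Prop := exists2 x, D x & V x != 0.

Definition unique_nontrivial_viscosity_solution (D bD : set 'cV[R]_n)
    (F : 'cV[R]_n -> R -> 'cV[R]_n -> 'M[R]_n -> R)
    (b : 'cV[R]_n -> R) (V : 'cV[R]_n -> R) : Prop :=
  [/\ viscosity_solution D bD F b V, nontrivial_on D V &
      forall W, viscosity_solution D bD F b W -> nontrivial_on D W ->
        forall x, D x -> W x = V x].

End Viscosity.

Section Equations.
Context {R : realType} {n p r k m : nat}.
Variables (pb : problem R n p r k m) (lambda : R).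
Implicit Types (x v : 'cV[R]_n) (X : 'M[R]_n) (s : R).

Definition Sigma x : 'M[R]_n :=
  pevmx (pb_B pb) x *m pb_Sig pb *m (pevmx (pb_B pb) x)^T.

Definition F_HJB x s v X : R :=
  - (pev (pb_q pb) x + dotp v (pevmx (pb_f pb) x)
     - 2^-1 * dotp v (pevmx (pb_G pb) x *m invmx (pb_R pb)
                        *m (pevmx (pb_G pb) x)^T *m v)
     + 2^-1 * \tr (X *m Sigma x)).

Definition F_lin x s v X : R :=
  - (- (lambda^-1 * pev (pb_q pb) x * s)
     + (dotp (pevmx (pb_f pb) x) v + 2^-1 * \tr (X *m Sigma x))).

Definition HJB_solution (V : 'cV[R]_n -> R) : Prop :=
  unique_nontrivial_viscosity_solution (Omega pb) (bndOmega pb) F_HJB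
    (pev (pb_phi pb)) V.

Definition desirability (x : 'cV[R]_n) : R := expR (- pev (pb_phi pb) x / lambda).

Definition linear_solution (Psi : 'cV[R]_n -> R) : Prop :=
  unique_nontrivial_viscosity_solution (Omega pb) (bndOmega pb) F_lin
    desirability Psi.

End Equations.

Section Stochastic.
Context {R : realType} {dOm : measure_display} {Om : measurableType dOm}.
Variables (P : probability Om R) (Filt : R -> set (set Om)).
Let mu : {measure set (measurableTypeR R) -> \bar R} := @lebesgue_measure R.

Definition filtration : Prop :=
  [/\ forall t, 0 <= t -> sigma_algebra [set: Om] (Filt t),
      forall t, 0 <= t -> Filt t `<=` measurable &
      forall s t, 0 <= s -> s <= t -> Filt s `<=` Filt t].

Definition adapted a (X : R -> Om -> 'cV[R]_a) : Prop :=
  forall t, 0 <= t -> forall i (U : set (measurableTypeR R)), measurable U ->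
    Filt t ((fun o => X t o i 0) @^-1` U).

Definition continuous_paths a (X : R -> Om -> 'cV[R]_a) : Prop :=
  forall o, {within [set t : R | 0 <= t], continuous (fun t => X t o)}.

(* normal_prob is not the point mass when its standard deviation is 0 *)
Definition centered_gaussian (v : R) (U : set (measurableTypeR R)) : \bar R :=
  if v == 0 then \d_(0%R : measurableTypeR R) U
  else normal_prob 0 (Num.sqrt v) U.

(* Brownian motion relative to Filt with covariance S.  That w t - w s is an
   N(0, (t - s) S) vector independent of Filt s is expressed through its
   one-dimensional projections (Cramer-Wold). *)
Definition brownian r (S : 'M[R]_r) (w : R -> Om -> 'cV[R]_r) : Prop :=
  [/\ forall o, w 0 o = 0, continuous_paths w, adapted w &
      forall s t, 0 <= s -> s < t -> forall (c : 'cV[R]_r) (A : set Om)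
        (U : set (measurableTypeR R)), Filt s A -> measurable U ->
        P (A `&` [set o | U (dotp c (w t o - w s o))]) =
        (P A * centered_gaussian ((t - s) * dotp c (S *m c)) U)%E].

(* I is a continuous version of the Ito integral of H against w.  For a
   continuous adapted integrand H the integral over [0, t] is the limit in
   probability of the left-endpoint Riemann sums. *)
Definition ito_integral a r (H : R -> Om -> 'M[R]_(a, r)) (w : R -> Om -> 'cV[R]_r)
    (I : R -> Om -> 'cV[R]_a) : Prop :=
  [/\ continuous_paths I,
      forall t i, 0 <= t ->
        measurable_fun [set: Om] (fun o => I t o i 0 : measurableTypeR R) &
      forall t, 0 <= t -> forall i e, 0 < e ->
        (fun N : nat => P [set o | e <
           `| (\sum_(j < N.+1) H (t * j%:R / N.+1%:R) o *m
                 (w (t * j.+1%:R / N.+1%:R) o - w (t * j%:R / N.+1%:R) o)) i 0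
              - I t o i 0 |]) @ \oo --> 0%E].

Context {n p r k m : nat}.
Variables (pb : problem R n p r k m) (w : R -> Om -> 'cV[R]_r).
Implicit Types (x : R -> Om -> 'cV[R]_n) (u : R -> Om -> 'cV[R]_p).

(* first time at which the state is on the boundary or at the origin
   (+oo if this never happens) *)
Definition hitting_time x (o : Om) : \bar R :=
  ereal_inf [set t%:E | t in [set t : R | 0 <= t /\ bndOmega pb (x t o)]].

Definition drift x u (o : Om) (s : R) : 'cV[R]_n :=
  pevmx (pb_f pb) (x s o) + pevmx (pb_G pb) (x s o) *m u s o.

(* x starts at x0 and solves dx = (f + G u) dt + B dw up to the hitting time;
   afterwards x is an arbitrary continuous adapted continuation. *)
Record admissible (x0 : 'cV[R]_n) x u : Prop := Admissible {
  adm_init : forall o, x 0 o = x0;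
  adm_cont : continuous_paths x;
  adm_adapted : adapted x;
  adm_control : adapted u;
  adm_control_meas : forall i, measurable_fun [set: measurableTypeR R * Om]
    (fun so => u so.1 so.2 i 0 : measurableTypeR R);
  adm_sde : exists2 I : R -> Om -> 'cV[R]_n,
    ito_integral (fun t o => pevmx (pb_B pb) (x t o)) w I &
    {ae P, forall o, forall t, 0 <= t -> (t%:E <= hitting_time x o)%E -> forall i,
       mu.-integrable `[0, t] (fun s => (drift x u o s i 0)%:E) /\
       x t o i 0 = x0 i 0 + \int[mu]_(s in `[0, t]) (drift x u o s i 0)
                   + I t o i 0}
}.

(* No terminal cost is charged on paths along which T = +oo. *)
Definition terminal_cost x (o : Om) : R :=
  if hitting_time x o is t%:E then pev (pb_phi pb) (x t o) else 0.

Definition running_cost x u (o : Om) (t : R) : R :=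
  pev (pb_q pb) (x t o) + 2^-1 * dotp (u t o) (pb_R pb *m u t o).

Definition cost x u : \bar R :=
  (\int[P]_o ((terminal_cost x o)%:E +
     \int[mu]_(t in [set t : R | (0 <= t)%R /\ t%:E <= hitting_time x o])
       (running_cost x u o t)%:E))%E.

Definition value_function (V : 'cV[R]_n -> R) : Prop :=
  forall x0 : 'cV[R]_n, Omega pb x0 ->
    (exists x u, admissible x0 x u /\ cost x u = (V x0)%:E) /\
    (forall x u, admissible x0 x u -> ((V x0)%:E <= cost x u)%E).

End Stochastic.

Section SOS.
Context {R : realType} {n p r k m : nat}.
Variables (pb : problem R n p r k m) (lambda : R).

Definition grad (Psi : pol R n) : 'cV[pol R n]_n := \col_i mpoly.mderiv i Psi.
Definition hessian (Psi : pol R n) : 'M[pol R n]_n :=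
  \matrix_(i, j) mpoly.mderiv i (mpoly.mderiv j Psi).

Definition SigmaP : 'M[pol R n]_n :=
  pb_B pb *m map_mx (fun c => mpoly.mpolyC n c) (pb_Sig pb) *m (pb_B pb)^T.

Definition opL (Psi : pol R n) : pol R n :=
  ((pb_f pb)^T *m grad Psi) 0 0 + 2^-1 *: \tr (hessian Psi *m SigmaP).

Definition opD (J : finType) (g : J -> pol R n) (s : {ffun J -> bool} -> pol R n)
    : pol R n :=
  \sum_(nu : {ffun J -> bool}) s nu * \prod_(i : J) g i ^+ nu i.

(* B(q, bndOmega, t) \in S[x] *)
Definition opB_sos (q : pol R n) (t : 'I_m -> pol R n) : Prop :=
  forall i, sos (q - t i * pb_h pb i).

(* the constraints defining Omega together with c >= 0 *)
Definition add_constraint (c : pol R n) : option 'I_k -> pol R n := oapp (pb_g pb) c.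

Record sos_vars := SosVars {
  Psi_l : pol R n;
  Psi_u : pol R n;
  S1 : {ffun 'I_k -> bool} -> pol R n;
  S2 : {ffun 'I_k -> bool} -> pol R n;
  S3 : {ffun 'I_k -> bool} -> pol R n;
  S4 : {ffun option 'I_k -> bool} -> pol R n;
  S5 : {ffun option 'I_k -> bool} -> pol R n;
  T1 : 'I_m -> pol R n;
  T2 : 'I_m -> pol R n;
  T3 : 'I_m -> pol R n;
  eps : R
}.

Definition multiplier (d : nat) (a : pol R n) : Prop := sos a /\ deg_le d a.

(* psi is a polynomial that agrees with the boundary data on bndOmega; S4 and
   S5 are shared by all the coordinates. *)
Record feasible (psi : pol R n) (d : nat) (z : sos_vars) : Prop := Feasible {
  fs_degl : deg_le d (Psi_l z);
  fs_degu : deg_le d (Psi_u z);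
  fs_S1 : forall nu, multiplier d (S1 z nu);
  fs_S2 : forall nu, multiplier d (S2 z nu);
  fs_S3 : forall nu, multiplier d (S3 z nu);
  fs_S4 : forall nu, multiplier d (S4 z nu);
  fs_S5 : forall nu, multiplier d (S5 z nu);
  fs_T1 : forall i, deg_le d (T1 z i);
  fs_T2 : forall i, deg_le d (T2 z i);
  fs_T3 : forall i, deg_le d (T3 z i);
  fs_sub : sos (- (lambda^-1 *: (pb_q pb * Psi_l z)) + opL (Psi_l z)
                - opD (pb_g pb) (S1 z));
  fs_super : sos (lambda^-1 *: (pb_q pb * Psi_u z) - opL (Psi_u z)
                  - opD (pb_g pb) (S2 z));
  fs_gap : sos (mpoly.mpolyC n (eps z) - (Psi_u z - Psi_l z)
                - opD (pb_g pb) (S3 z));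
  fs_bnd0 : opB_sos (Psi_l z) (T1 z);
  fs_bndl : opB_sos (psi - Psi_l z) (T2 z);
  fs_bndu : opB_sos (Psi_u z - psi) (T3 z);
  fs_mono_pos : forall i : 'I_n,
    sos (- mpoly.mderiv i (Psi_l z) - opD (add_constraint (pvar i)) (S4 z));
  fs_mono_neg : forall i : 'I_n,
    sos (mpoly.mderiv i (Psi_l z) - opD (add_constraint (- pvar i)) (S5 z));
  fs_origin : pev (Psi_l z) 0 = 1
}.

Definition sos_solution (psi : pol R n) (d : nat) (z : sos_vars) : Prop :=
  feasible psi d z /\ forall z', feasible psi d z' -> eps z <= eps z'.

(* V_u = - lambda log Psi_l; lne is -oo at nonpositive arguments. *)
Definition V_u (z : sos_vars) (x : 'cV[R]_n) : \bar R :=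
  (- (lambda%:E * lne (pev (Psi_l z) x)%:E))%E.

End SOS.
Arguments sos_vars : clear implicits.

Definition psd {R : realType} {a} (A : 'M[R]_a) : Prop :=
  A^T = A /\ forall v : 'cV[R]_a, 0 <= dotp v (A *m v).

Definition posdef {R : realType} {a} (A : 'M[R]_a) : Prop :=
  A^T = A /\ forall v : 'cV[R]_a, v != 0 -> 0 < dotp v (A *m v).

Definition pos_definite_on {R : realType} {n} (D : set 'cV[R]_n) (a : pol R n) : Prop :=
  pev a 0 = 0 /\ forall x, D x -> x != 0 -> 0 < pev a x.

Record standing_assumptions (R : realType) (n p r k m : nat)
    (pb : problem R n p r k m) (lambda : R) : Prop := StandingAssumptions {
  sa_compact : compact (Omega pb);
  sa_origin : Omega pb 0;
  sa_bnd : bndOmega pb = [set x | \prod_(i < m) pev (pb_h pb i) x = 0];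
  sa_f0 : pevmx (pb_f pb) 0 = 0;
  sa_G0 : pevmx (pb_G pb) 0 = 0;
  sa_B0 : pevmx (pb_B pb) 0 = 0;
  sa_Sig : psd (pb_Sig pb);
  sa_R : posdef (pb_R pb);
  sa_phi_ge0 : forall x, 0 <= pev (pb_phi pb) x;
  sa_q_ge0 : forall x, 0 <= pev (pb_q pb) x;
  sa_phi : pos_definite_on (Omega pb) (pb_phi pb);
  sa_q : pos_definite_on (Omega pb) (pb_q pb);
  sa_lambda : 0 < lambda;
  sa_noise : forall x,
    lambda *: (pevmx (pb_G pb) x *m invmx (pb_R pb) *m (pevmx (pb_G pb) x)^T)
    = Sigma pb x
}.

(* Main.v *)
Require Import Defs.
From HB Require Import structures.
From mathcomp Require Import all_boot all_order all_algebra.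
From mathcomp Require Import all_classical all_reals all_analysis.
From mathcomp Require Import ring lra.
(* The notations of mpoly clash with those of the analysis files. *)
From mathcomp Require Import (canonicals) mpoly.

Set Implicit Arguments.
Unset Strict Implicit.
Unset Printing Implicit Defensive.

Import Order.TTheory GRing.Theory Num.Theory.
Import numFieldNormedType.Exports.

Local Open Scope classical_set_scope.
Local Open Scope ring_scope.

(** The polynomials [Psi_l] and [Psi_u] are a classical subsolution and a
    classical supersolution of the linear equation, and they lie below and above
    the Dirichlet data.  The sum of squares certificates give exactly this.  The
    comparison principle then puts the viscosity solution [Psistar] between
    them, and the third certificate bounds the width of the bracket by [eps].
    Hence [Psistar - eps <= Psi_l <= Psistar] on [Omega].  Taking
    [- lambda log], which is decreasing, gives [Vstar <= V_u], and since
    [eta <= Psistar] one gets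
    [Psi_l / Psistar >= 1 - eps / Psistar >= 1 - eps / eta], which is the upper
    estimate; when [eps >= eta] the right-hand side is [+oo].

    A polynomial is smooth, so it is itself the test function in the comparison
    with a viscosity solution.  Let [c] minimize [Psistar - Psi_l] on the compact
    set [Omega], and suppose that the minimum is negative.  Then [c]
    is not a boundary point, so it is an interior point different from the
    origin.  There [Psi_l] touches [Psistar] from below up to a constant, so its
    gradient and Hessian form an element of the subjet of [Psistar]
    ([subjet_touching]).  The viscosity inequality holds for this jet with the
    value [Psistar c], the classical one with the larger value [Psi_l c].  As
    [q > 0] away from the origin, the equation is strictly increasing in the
    value, and the two inequalities contradict each other
    ([classical_subsolution_le]).  The proof for [Psi_u] is symmetric.

    The analytic ingredient is the second order Taylor formula for multivariate
    polynomials ([pev_taylor]).  It is proved by induction on the ring structure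
    ([taylor2_cubic]), with the directional derivative [ddir d] as a derivation:
    the expansion of a product is the product of the expansions up to terms of
    order three. *)

(** * Evaluation and Taylor expansion of multivariate polynomials *)

Section Evaluation.
Context {R : realType} {n : nat}.
Implicit Types (p q : pol R n) (x y d : 'cV[R]_n).

Lemma pevD p q x : pev (p + q) x = pev p x + pev q x.
Proof. exact: mpoly.mevalD. Qed.

Lemma pevB p q x : pev (p - q) x = pev p x - pev q x.
Proof. exact: mpoly.mevalB. Qed.

Lemma pevN p x : pev (- p) x = - pev p x.
Proof. exact: mpoly.mevalN. Qed.

Lemma pevM p q x : pev (p * q) x = pev p x * pev q x.
Proof. exact: mpoly.mevalM. Qed.

Lemma pevZ c p x : pev (c *: p) x = c * pev p x.
Proof. exact: mpoly.mevalZ. Qed.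

Lemma pevC c x : pev (mpoly.mpolyC n c) x = c.
Proof. exact: mpoly.mevalC. Qed.

Lemma pev_pvar i x : pev (pvar (R := R) i) x = x i 0.
Proof. exact: mpoly.mevalXU. Qed.

Lemma pev_sum (I : Type) (s : seq I) (Q : pred I) (F : I -> pol R n) x :
  pev (\sum_(i <- s | Q i) F i) x = \sum_(i <- s | Q i) pev (F i) x.
Proof. by rewrite /pev raddf_sum. Qed.

Lemma pev_prod (I : Type) (s : seq I) (Q : pred I) (F : I -> pol R n) x :
  pev (\prod_(i <- s | Q i) F i) x = \prod_(i <- s | Q i) pev (F i) x.
Proof. by rewrite /pev rmorph_prod. Qed.

Lemma pev_exp p j x : pev (p ^+ j) x = pev p x ^+ j.
Proof. by rewrite /pev rmorphXn. Qed.

Lemma pol_ring_ind (Q : pol R n -> Prop) :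
  (forall c, Q (mpoly.mpolyC n c)) -> (forall i, Q (pvar i)) ->
  (forall p q, Q p -> Q q -> Q (p + q)) ->
  (forall p q, Q p -> Q q -> Q (p * q)) -> forall p, Q p.
Proof.
move=> QC QX QD QM; elim/mpoly.mpolyind.
  by rewrite -(mpoly.mpolyC0 n R); exact: QC.
move=> c mm p _ _ Qp; apply: (QD) => //.
rewrite -mpoly.mul_mpolyC; apply: (QM); first exact: QC.
rewrite mpoly.mpolyXE_id; apply: (big_ind Q); [exact: (QC 1)|exact: QM|].
move=> i _; elim: (X in _ ^+ X) => [|j IH]; first exact: (QC 1).
by rewrite exprS; apply: (QM) => //; exact: QX.
Qed.

Lemma pev_continuous p : continuous (pev p).
Proof.
elim/pol_ring_ind: p => [c|i|p q cp cq|p q cp cq] x.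
- rewrite (_ : pev _ = fun=> c); last by apply/funext => y; rewrite pevC.
  exact: cst_continuous.
- rewrite (_ : pev _ = fun y : 'cV[R]_n => y i 0); first exact: coord_continuous.
  by apply/funext => y; rewrite pev_pvar.
- rewrite (_ : pev _ = pev p \+ pev q); last by apply/funext => y; rewrite pevD.
  exact: (@continuousD _ _ _ (pev p) (pev q) x (cp x) (cq x)).
- rewrite (_ : pev _ = pev p \* pev q); last by apply/funext => y; rewrite pevM.
  exact: (@continuousM _ _ (pev p) (pev q) x (cp x) (cq x)).
Qed.

Definition ddir d p : pol R n := \sum_i d i 0 *: mpoly.mderiv i p.

Lemma ddirC d c : ddir d (mpoly.mpolyC n c) = 0.
Proof. by rewrite /ddir big1 // => i _; rewrite mpoly.mderivC scaler0. Qed.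

Lemma ddirD d p q : ddir d (p + q) = ddir d p + ddir d q.
Proof.
by rewrite /ddir -big_split; apply: eq_bigr => i _; rewrite mpoly.mderivD scalerDr.
Qed.

Lemma ddirM d p q : ddir d (p * q) = ddir d p * q + p * ddir d q.
Proof.
rewrite /ddir mulr_suml mulr_sumr -big_split; apply: eq_bigr => i _ /=.
by rewrite mpoly.mderivM scalerDr scalerAl scalerAr.
Qed.

Lemma ddir_pvar d i : ddir d (pvar i) = mpoly.mpolyC n (d i 0).
Proof.
rewrite /ddir (bigD1 i) //= big1 ?addr0 => [|j ji].
  rewrite /pvar mpoly.mderivX mpoly.mnm1E eqxx scale1r.
  have -> : mpoly.mnm_sub (mpoly.mnm1 i) (mpoly.mnm1 i) = mpoly.mnm0 (n:=n).
    by apply/mpoly.mnmP => a; rewrite mpoly.mnmBE mpoly.mnm0E subnn.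
  by rewrite mpoly.mpolyX0 -mpoly.alg_mpolyC.
by rewrite /pvar mpoly.mderivX mpoly.mnm1E eq_sym (negbTE ji) scale0r scaler0.
Qed.

(** With its additive companion below, these let the error terms of a product be
    bounded factor by factor. *)
Lemma ler_normM_le (a b A B : R) :
  `|a| <= A -> `|b| <= B -> `|a * b| <= A * B.
Proof. by move=> ha hb; rewrite normrM; apply: ler_pM. Qed.

Lemma ler_normD_le (a b A B : R) :
  `|a| <= A -> `|b| <= B -> `|a + b| <= A + B.
Proof. by move=> ha hb; apply: le_trans (ler_normD _ _) _; apply: lerD. Qed.

Definition taylor2 p x d : R :=
  pev p x + pev (ddir d p) x + 2^-1 * pev (ddir d (ddir d p)) x.

(** The proof is by induction on [p], and bounds on the first and second
    directional derivatives are carried along because the product step needs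
    them: if [p = a + a1 + a2 + rp] and [q = b + b1 + b2 + rq] are the expansions
    into orders 0, 1, 2 and a remainder, then the remainder of [p * q] is
    [rp * q + (a + a1 + a2) * rq + (a1 * b2 + a2 * b1 + a2 * b2)].  The bound [N]
    on the coordinates of [d] is a parameter so that no norm has to be chosen
    at this stage. *)
Lemma taylor2_cubic p x : exists2 C : R, 0 <= C &
  forall d N, 0 <= N <= 1 -> (forall i, `|d i 0| <= N) ->
  [/\ `|pev (ddir d p) x| <= C * N,
      `|pev (ddir d (ddir d p)) x| <= C * N ^+ 2 &
      `|pev p (x + d) - taylor2 p x d| <= C * N ^+ 3].
Proof.
elim/pol_ring_ind: p => [c|i|p q [Cp Cp0 hp] [Cq Cq0 hq]|p q [Cp Cp0 hp] [Cq Cq0 hq]].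
- exists 0 => // d N N01 _; rewrite /taylor2 ddirC -(mpoly.mpolyC0 n R) ddirC !pevC.
  by rewrite mulr0 !addr0 subrr normr0 !mul0r.
- exists 1 => // d N /andP[N0 N1] dN.
  rewrite /taylor2 ddir_pvar ddirC -(mpoly.mpolyC0 n R) !pevC !pev_pvar mxE.
  rewrite mulr0 addr0 subrr normr0 !mul1r; split => //; exact: exprn_ge0.
- exists (Cp + Cq); first exact: addr_ge0.
  move=> d N N01 dN.
  have [p1 p2 p3] := hp d N N01 dN; have [q1 q2 q3] := hq d N N01 dN.
  rewrite /taylor2 !ddirD !pevD !mulrDl; split; try exact: ler_normD_le.
  rewrite [X in `|X|](_ : _ = (pev p (x + d) - taylor2 p x d)
    + (pev q (x + d) - taylor2 q x d)); last by rewrite /taylor2; ring.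
  exact: ler_normD_le.
- set A := `|pev p x|; set B := `|pev q x|.
  have A0 : 0 <= A by exact: normr_ge0.
  have B0 : 0 <= B by exact: normr_ge0.
  have CC0 : 0 <= Cp * Cq by exact: mulr_ge0.
  have BC0 : 0 <= B * Cp by exact: mulr_ge0.
  have AC0 : 0 <= A * Cq by exact: mulr_ge0.
  (* the constant needed by the third bound: 8 = 3 + 2 + 3 products Cp * Cq come
     from the sizes of q (x + d), of taylor2 p x d and of the orders above two *)
  exists (A * Cq + B * Cp + 8 * (Cp * Cq)); first lra.
  move=> d N N01 dN.
  have [p1 p2 p3] := hp d N N01 dN; have [q1 q2 q3] := hq d N N01 dN.
  have /andP[N0 N1] := N01.
  have N2 : 0 <= N ^+ 2 <= 1 by rewrite exprn_ge0 // exprn_ile1.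
  have N3 : 0 <= N ^+ 3 <= 1 by rewrite exprn_ge0 // exprn_ile1.
  have hA : `|pev p x| <= A by [].
  have hB : `|pev q x| <= B by [].
  rewrite /taylor2 !(ddirM, ddirD) !(pevM, pevD).
  move: hA hB p1 p2 p3 q1 q2 q3; rewrite /taylor2.
  move: (pev p x) (pev q x) (pev (ddir d p) x) (pev (ddir d q) x)
    (pev (ddir d (ddir d p)) x) (pev (ddir d (ddir d q)) x)
    (pev p (x + d)) (pev q (x + d)) => a b a1 b1 a2 b2 py qy.
  move=> ha hb p1 p2 p3 q1 q2 q3.
  have le1 (C z : R) : 0 <= C -> 0 <= z <= 1 -> C * z <= C.
    by move=> C0 /andP[z0 z1]; rewrite -[leRHS]mulr1 ler_wpM2l.
  have half : `|2^-1 : R| <= 1 by rewrite ger0_norm; lra.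
  split.
  + apply: (@le_trans _ _ (Cp * N * B + A * (Cq * N))).
      by apply: ler_normD_le; apply: ler_normM_le.
    have : 0 <= 8 * (Cp * Cq) * N by rewrite !mulr_ge0.
    lra.
  + apply: (@le_trans _ _ (Cp * N ^+ 2 * B + (Cp * N) * (Cq * N)
        + ((Cp * N) * (Cq * N) + A * (Cq * N ^+ 2)))).
      by do ?apply: ler_normD_le; apply: ler_normM_le.
    have : 0 <= Cp * Cq * N ^+ 2 by rewrite !mulr_ge0 ?exprn_ge0.
    lra.
  + have tp : `|a + a1 + 2^-1 * a2| <= A + 2 * Cp.
      apply: (@le_trans _ _ (A + Cp * N + 1 * (Cp * N ^+ 2))).
        by do 2?apply: ler_normD_le => //; apply: ler_normM_le.
      have := le1 _ _ Cp0 N01; have := le1 _ _ Cp0 N2; lra.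
    have tq : `|qy| <= B + 3 * Cq.
      rewrite (_ : qy = (qy - (b + b1 + 2^-1 * b2)) + (b + b1 + 2^-1 * b2)); last ring.
      apply: (@le_trans _ _ (Cq * N ^+ 3 + (B + Cq * N + 1 * (Cq * N ^+ 2)))).
        do ?[apply: ler_normD_le => //]; exact: ler_normM_le.
      by have := le1 _ _ Cq0 N01; have := le1 _ _ Cq0 N2; have := le1 _ _ Cq0 N3; lra.
    rewrite [X in `|X|](_ : _ = (py - (a + a1 + 2^-1 * a2)) * qy
      + (a + a1 + 2^-1 * a2) * (qy - (b + b1 + 2^-1 * b2))
      + (2^-1 * (a1 * b2) + 2^-1 * (a2 * b1) + (2^-1 * a2) * (2^-1 * b2))); last by field.
    apply: (@le_trans _ _ (Cp * N ^+ 3 * (B + 3 * Cq) + (A + 2 * Cp) * (Cq * N ^+ 3)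
      + (1 * (Cp * N * (Cq * N ^+ 2)) + 1 * (Cp * N ^+ 2 * (Cq * N))
         + 1 * (Cp * N ^+ 2) * (1 * (Cq * N ^+ 2))))).
      by do ?[apply: ler_normD_le => //]; do ?[apply: ler_normM_le => //].
    have : Cp * Cq * N ^+ 3 * N <= Cp * Cq * N ^+ 3.
      by apply: le1 => //; rewrite mulr_ge0 // exprn_ge0.
    nra.
Qed.

End Evaluation.

(** * Jets of polynomials *)

Section Jets.
Context {R : realType} {n : nat}.
Implicit Types (p : pol R n) (x y d : 'cV[R]_n) (V : 'cV[R]_n -> R).

Definition gradv p x : 'cV[R]_n := pevmx (grad p) x.
Definition hessv p x : 'M[R]_n := pevmx (hessian p) x.

Lemma dotpE (u v : 'cV[R]_n) : dotp u v = \sum_i u i 0 * v i 0.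
Proof. by rewrite /dotp mxE; apply: eq_bigr => i _; rewrite mxE. Qed.

Lemma pev_ddir d p x : pev (ddir d p) x = \sum_i d i 0 * pev (mpoly.mderiv i p) x.
Proof. by rewrite pev_sum; apply: eq_bigr => i _; rewrite pevZ. Qed.

Lemma taylor2_quad p x y :
  taylor2 p x (y - x) = quad (pev p) x (gradv p x) (hessv p x) y.
Proof.
rewrite /taylor2 /quad; congr (_ + _ + _ * _).
  by rewrite pev_ddir dotpE; apply: eq_bigr => i _; rewrite !mxE mulrC.
rewrite pev_ddir dotpE; apply: eq_bigr => i _; congr (_ * _).
rewrite mxE /ddir raddf_sum pev_sum; apply: eq_bigr => j _ /=.
by rewrite mpoly.mderivZ pevZ !mxE mulrC.
Qed.

Lemma hessv_sym p x : (hessv p x)^T = hessv p x.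
Proof. by apply/matrixP => i j; rewrite !mxE mpoly.mderiv_comm. Qed.

Lemma dotp_self_ge0 d : 0 <= dotp d d.
Proof. by rewrite dotpE sumr_ge0 // => i _; rewrite -expr2 sqr_ge0. Qed.

Lemma coord_le_sqrt_dotp d i : `|d i 0| <= Num.sqrt (dotp d d).
Proof.
rewrite -sqrtr_sqr ler_wsqrtr // dotpE (bigD1 i) //= -expr2 lerDl.
by rewrite sumr_ge0 // => j _; rewrite -expr2 sqr_ge0.
Qed.

(** The squared distance to [x] is itself a polynomial, so that its continuity is
    an instance of that of polynomials. *)
Lemma near_dotp x e : 0 < e -> \forall y \near x, dotp (y - x) (y - x) < e.
Proof.
move=> e0.
pose s : pol R n := \sum_i (pvar i - mpoly.mpolyC n (x i 0)) ^+ 2.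
have sE y : pev s y = dotp (y - x) (y - x).
  rewrite pev_sum dotpE; apply: eq_bigr => i _.
  by rewrite pev_exp pevB pev_pvar pevC !mxE expr2.
have s0 : pev s x < e by rewrite sE subrr /dotp mulmx0 mxE.
have near_s : \forall y \near x, pev s y < e.
  exact: (@pev_continuous _ _ s x _ (lt_nbhsl s0)).
near=> y; rewrite -sE; near: y; exact: near_s.
Unshelve. all: by end_near. Qed.

(** The cubic remainder is at most [C * N * N ^+ 2], where [N] is the Euclidean
    length of [y - x], and [C * N <= e] near [x]. *)
Lemma pev_taylor p x e : 0 < e -> \forall y \near x,
  `|pev p y - quad (pev p) x (gradv p x) (hessv p x) y| <= e * dotp (y - x) (y - x).
Proof.
move=> e0; have [C C0 hC] := taylor2_cubic p x.
have C1 : 0 < C + 1 by rewrite ltr_wpDl.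
pose r := Num.min 1 (e / (C + 1)).
have r0 : 0 < r by rewrite lt_min ltr01 divr_gt0.
near=> y.
set N := Num.sqrt (dotp (y - x) (y - x)).
have N0 : 0 <= N by exact: sqrtr_ge0.
have N2 : N ^+ 2 = dotp (y - x) (y - x) by rewrite sqr_sqrtr // dotp_self_ge0.
have Nr : N < r.
  rewrite -(@ltr_pXn2r _ 2) ?nnegrE ?(ltW r0) // N2.
  by near: y; apply: near_dotp; rewrite exprn_gt0.
have [N1 Ne] : N <= 1 /\ (C + 1) * N <= e.
  move: (ltW Nr); rewrite le_min => /andP[-> ]; split => //.
  by rewrite mulrC -ler_pdivlMr.
have [|i|_ _] := hC (y - x) N; [by rewrite N0 N1|exact: coord_le_sqrt_dotp|].
rewrite taylor2_quad [x + _]addrC subrK => /le_trans; apply.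
rewrite -N2 exprSr [C * _]mulrA [leRHS]mulrC -mulrA [leLHS]mulrCA ler_wpM2l ?sqr_ge0 //.
by apply: le_trans Ne; rewrite ler_wpM2r // lerDl.
Unshelve. all: by end_near. Qed.

(** [V] stays above [p] shifted by the constant [V x - pev p x], and [p] agrees
    with its expansion up to [o(|y - x|^2)]; so the 2-jet of [p] is a test jet. *)
Lemma subjet_touching p V x :
  (\forall y \near x, V x - pev p x <= V y - pev p y) ->
  subjet V x (gradv p x) (hessv p x).
Proof.
move=> hV; split=> [|e e0]; first exact: hessv_sym.
near=> y.
have h1 : V x - pev p x <= V y - pev p y by near: y.
have : `|pev p y - quad (pev p) x (gradv p x) (hessv p x) y|
    <= e * dotp (y - x) (y - x) by near: y; exact: pev_taylor.
rewrite ler_norml /quad => /andP[h2 _]; lra.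
Unshelve. all: by end_near. Qed.

Lemma superjet_touching p V x :
  (\forall y \near x, V y - pev p y <= V x - pev p x) ->
  superjet V x (gradv p x) (hessv p x).
Proof.
move=> hV; split=> [|e e0]; first exact: hessv_sym.
near=> y.
have h1 : V y - pev p y <= V x - pev p x by near: y.
have : `|pev p y - quad (pev p) x (gradv p x) (hessv p x) y|
    <= e * dotp (y - x) (y - x) by near: y; exact: pev_taylor.
rewrite ler_norml /quad => /andP[_ h2]; lra.
Unshelve. all: by end_near. Qed.

(** * Comparison of polynomials with viscosity solutions *)

Section Comparison.
Context (D bD : set 'cV[R]_n) (F : 'cV[R]_n -> R -> 'cV[R]_n -> 'M[R]_n -> R).
Context (b V : 'cV[R]_n -> R).
Context (cD : compact D).
Context (intD : D `\` bD `<=` D°).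
Context (Fmono : forall x s t v X, (D `\` bD) x -> s < t -> F x s v X < F x t v X).
Context (VF : viscosity_solution D bD F b V).

Lemma within_continuousBpev p : {within D, continuous (fun x => V x - pev p x)}.
Proof.
have [cV _ _ _] := VF.
move=> x; apply: (@continuousB _ _ _ (V : subspace D -> R) (pev p)); first exact: cV.
by apply: continuous_subspaceT; exact: pev_continuous.
Qed.

(** At a negative minimum [c] of [V - p] the 2-jet of [p] is in the subjet of [V],
    whence [0 <= F c (V c) _ _ < F c (pev p c) _ _ <= 0]. *)
Lemma classical_subsolution_le p :
  (forall x, (D `\` bD) x -> F x (pev p x) (gradv p x) (hessv p x) <= 0) ->
  (forall x, bD x -> pev p x <= b x) ->
  forall x, D x -> pev p x <= V x.
Proof.
move=> subp bp x Dx; have [_ _ Vsub Vb] := VF.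
have [|c cDD cmin] := compact_EVT_min _ cD (@within_continuousBpev p).
  by exists x.
suff : 0 <= V c - pev p c.
  move=> c0; rewrite -subr_ge0; apply: le_trans c0 _.
  by apply: cmin; rewrite inE.
rewrite subr_ge0; have {}cDD := set_mem cDD.
have [bc|nbc] := pselect (bD c); first by rewrite Vb // bp.
have cc : (D `\` bD) c by [].
rewrite leNgt; apply/negP => Vp.
(* touching from below near c, since D is a neighborhood of c *)
have /(Vsub _ _ _ cc) : subjet V c (gradv p c) (hessv p c).
  apply: subjet_touching; have := intD cc; apply: filterS => y Dy.
  by apply: cmin; rewrite inE.
by apply/negP; rewrite -ltNge (lt_le_trans (Fmono _ _ cc Vp)) // subp.
Qed.

Lemma le_classical_supersolution p :
  (forall x, (D `\` bD) x -> 0 <= F x (pev p x) (gradv p x) (hessv p x)) ->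
  (forall x, bD x -> b x <= pev p x) ->
  forall x, D x -> V x <= pev p x.
Proof.
move=> supp bp x Dx; have [_ Vsup _ Vb] := VF.
have [|c cDD cmax] := compact_EVT_max _ cD (@within_continuousBpev p).
  by exists x.
suff : V c - pev p c <= 0.
  move=> c0; rewrite -subr_le0; apply: le_trans c0.
  by apply: cmax; rewrite inE.
rewrite subr_le0; have {}cDD := set_mem cDD.
have [bc|nbc] := pselect (bD c); first by rewrite Vb // bp.
have cc : (D `\` bD) c by [].
rewrite leNgt; apply/negP => Vp.
have /(Vsup _ _ _ cc) : superjet V c (gradv p c) (hessv p c).
  apply: superjet_touching; have := intD cc; apply: filterS => y Dy.
  by apply: cmax; rewrite inE.
by apply/negP; rewrite -ltNge (le_lt_trans _ (Fmono _ _ cc Vp)) // supp.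
Qed.

End Comparison.
End Jets.

(** * Sum of squares certificates *)

Section Certificates.
Context {R : realType} {n p r k m : nat}.
Context (pb : problem R n p r k m) (lambda : R).
Implicit Types (a : pol R n) (x : 'cV[R]_n).

Lemma sos_ge0 a x : sos a -> 0 <= pev a x.
Proof.
by case=> s ->; rewrite pev_sum sumr_ge0 // => b _; rewrite pev_exp sqr_ge0.
Qed.

Lemma opD_ge0 (J : finType) (g : J -> pol R n) s x :
  (forall nu, sos (s nu)) -> (forall j, 0 <= pev (g j) x) -> 0 <= pev (opD g s) x.
Proof.
move=> ss gx; rewrite pev_sum sumr_ge0 // => nu _; rewrite pevM mulr_ge0 //.
  exact: sos_ge0.
by rewrite pev_prod prodr_ge0 // => j _; rewrite pev_exp exprn_ge0.
Qed.

Lemma sosB_opD_ge0 a d s x :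
  Omega pb x -> (forall nu, multiplier d (s nu)) -> sos (a - opD (pb_g pb) s) ->
  0 <= pev a x.
Proof.
move=> Ox ss /sos_ge0 -/(_ x); rewrite pevB subr_ge0; apply: le_trans.
by apply: opD_ge0 => // nu; case: (ss nu).
Qed.

(** On the boundary the product of the [h i] vanishes, hence so does some factor,
    and the corresponding multiplier disappears from its certificate. *)
Lemma opB_sos_ge0 a t x :
  bndOmega pb = [set y | \prod_(i < m) pev (pb_h pb i) y = 0] ->
  bndOmega pb x -> opB_sos pb a t -> 0 <= pev a x.
Proof.
move=> -> /= /eqP /prodf_eq0[i _ /eqP hi] /(_ i) /sos_ge0 -/(_ x).
by rewrite pevB pevM hi mulr0 subr0.
Qed.

Lemma pevmxM n1 n2 n3 (A : 'M[pol R n]_(n1, n2)) (B : 'M[pol R n]_(n2, n3)) x :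
  pevmx (A *m B) x = pevmx A x *m pevmx B x.
Proof. exact: (map_mxM (mpoly.meval (fun i => x i 0))). Qed.

Lemma pevmx_SigmaP x : pevmx (SigmaP pb) x = Sigma pb x.
Proof.
rewrite /SigmaP !pevmxM /Sigma; congr (_ *m _ *m _); apply/matrixP => i j.
  by rewrite !mxE pevC.
by rewrite !mxE.
Qed.

Lemma pev_opL a x : pev (opL pb a) x =
  dotp (pevmx (pb_f pb) x) (gradv a x) + 2^-1 * \tr (hessv a x *m Sigma pb x).
Proof.
rewrite /opL pevD pevZ; congr (_ + _ * _).
  have -> (A : 'M[pol R n]_1) : pev (A 0 0) x = (pevmx A x) 0 0 by rewrite mxE.
  by rewrite pevmxM /dotp; congr ((_ *m _) 0 0); apply/matrixP => i j; rewrite !mxE.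
rewrite -pevmx_SigmaP -pevmxM.
exact/esym/(trace_map_mx (mpoly.meval (fun i => x i 0))).
Qed.

(** On the 2-jet of a polynomial the equation is, up to sign, the polynomial that
    the certificates of the program control. *)
Lemma F_lin_pol a x : F_lin pb lambda x (pev a x) (gradv a x) (hessv a x) =
  - pev (- (lambda^-1 *: (pb_q pb * a)) + opL pb a) x.
Proof. by rewrite /F_lin pevD pevN pevZ pevM pev_opL mulrA. Qed.

Lemma F_lin_increasing x s t v X :
  0 < lambda -> 0 < pev (pb_q pb) x -> s < t ->
  F_lin pb lambda x s v X < F_lin pb lambda x t v X.
Proof.
move=> l0 q0 st; rewrite /F_lin ltrN2 ltrD2r ltrN2 ltr_pM2l //.
by rewrite mulr_gt0 ?invr_gt0.
Qed.

Lemma Omega_interior x :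
  (Omega pb `\` bndOmega pb) x -> (Omega pb)° x /\ x != 0.
Proof.
move=> [Ox nb]; split; last by apply/eqP => x0; apply: nb; right.
by apply: contrapT => ni; apply: nb; left; split => //; exact: subset_closure.
Qed.

End Certificates.

(** * The viscosity solution lies between [Psi_l] and [Psi_u] *)

Section Bracketing.
Context {R : realType} {n p r k m : nat}.
Context (pb : problem R n p r k m) (lambda : R).
Context (Hpb : standing_assumptions pb lambda).
Context (Psi : 'cV[R]_n -> R) (psi : pol R n) (d : nat) (z : sos_vars R n k m).
Context (HPsi : viscosity_solution (Omega pb) (bndOmega pb) (F_lin pb lambda)
  (desirability pb lambda) Psi).
Context (Hpsi : forall x, bndOmega pb x -> pev psi x = desirability pb lambda x).
Context (Hz : feasible pb lambda psi d z).

Let Fmono x s t v X : (Omega pb `\` bndOmega pb) x -> s < t ->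
  F_lin pb lambda x s v X < F_lin pb lambda x t v X.
Proof.
move=> Dx; apply: F_lin_increasing; first exact: (sa_lambda Hpb).
have [_ x0] := Omega_interior Dx; have [Ox _] := Dx.
by have [_] := sa_q Hpb; apply.
Qed.

Let intO : Omega pb `\` bndOmega pb `<=` (Omega pb)°.
Proof. by move=> x /(Omega_interior)[]. Qed.

Lemma Psi_l_le x : Omega pb x -> pev (Psi_l z) x <= Psi x.
Proof.
apply: (classical_subsolution_le (sa_compact Hpb) intO Fmono HPsi) => y.
  move=> [Oy _]; rewrite F_lin_pol oppr_le0.
  exact: sosB_opD_ge0 (fs_S1 Hz) (fs_sub Hz).
move=> By; rewrite -Hpsi // -subr_ge0 -pevB.
exact: opB_sos_ge0 (sa_bnd Hpb) By (fs_bndl Hz).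
Qed.

Lemma Psi_u_ge x : Omega pb x -> Psi x <= pev (Psi_u z) x.
Proof.
apply: (le_classical_supersolution (sa_compact Hpb) intO Fmono HPsi) => y.
  move=> [Oy _]; rewrite F_lin_pol -pevN opprD opprK.
  exact: sosB_opD_ge0 (fs_S2 Hz) (fs_super Hz).
move=> By; rewrite -Hpsi // -subr_ge0 -pevB.
exact: opB_sos_ge0 (sa_bnd Hpb) By (fs_bndu Hz).
Qed.

Lemma Psi_gap x : Omega pb x -> Psi x - pev (Psi_l z) x <= eps z.
Proof.
move=> Ox; have := sosB_opD_ge0 Ox (fs_S3 Hz) (fs_gap Hz).
rewrite !pevB pevC; have := Psi_u_ge Ox; lra.
Qed.

End Bracketing.

(** * From desirability functions to value functions *)

(** The content is that the supremum is finite, [sup] being a default value on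
    unbounded sets; this comes from continuity on a compact set. *)
Lemma sup_norm_ge (R : realType) (n p r k m : nat) (pb : problem R n p r k m)
    (V : 'cV[R]_n -> R) x :
  compact (Omega pb) -> {within Omega pb, continuous V} -> Omega pb x ->
  `|V x| <= sup_norm pb V.
Proof.
move=> cO cV Ox; have cN : {within Omega pb, continuous (fun y => `|V y|)}.
  by move=> y; apply: continuous_comp; [exact: cV|exact: norm_continuous].
have [|c _ cmax] := compact_EVT_max _ cO cN; first by exists x.
apply: ub_le_sup; last by exists x.
by exists `|V c| => _ [y Oy <-]; apply: cmax; rewrite inE.
Qed.

(** Here [Q] and [L] stand for the values of the desirability function and of its
    lower bound at one point.  When [e < eta], [Q - e >= Q * (1 - e / eta)], because
    [eta <= Q]; so [L] is positive and the ratio [L / Q] is at least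
    [1 - e / eta].  The infinite values of [lne] cover [L <= 0] and
    [e >= eta]. *)
Lemma log_gap (R : realType) (lambda L Q e eta : R) :
  0 < lambda -> 0 < eta -> eta <= Q -> L <= Q -> Q - L <= e ->
  let V := (- (lambda%:E * lne Q%:E))%E in
  let U := (- (lambda%:E * lne L%:E))%E in
  (V <= U)%E /\ (U - V <= - (lambda%:E * lne (1 - Num.min 1 (e / eta))%:E))%E.
Proof.
move=> l0 eta0 etaQ LQ gap V U.
have Q0 : 0 < Q by exact: lt_le_trans etaQ.
have lneNy y : y <= 0 -> (- (lambda%:E * lne y%:E) = +oo :> \bar R)%E.
  by move=> y0; rewrite le0_lneNy ?lee_fin // gt0_muleNy ?lte_fin.
have lneE y : 0 < y -> (- (lambda%:E * lne y%:E) = (- (lambda * ln y))%:E :> \bar R)%E.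
  by move=> y0; rewrite lne_EFin.
split.
  rewrite /V /U lneE //; have [L0|L0] := leP L 0; first by rewrite lneNy // leey.
  by rewrite lneE // lee_fin lerN2 ler_pM2l // ler_ln.
have [e1|e1] := leP 1 (e / eta); first by rewrite subrr lneNy // leey.
have t0 : 0 < 1 - e / eta by rewrite subr_gt0.
have QL : Q * (1 - e / eta) <= L.
  have e0 : 0 <= e / eta by rewrite divr_ge0 ?(ltW eta0) //; lra.
  have : eta * (e / eta) <= Q * (e / eta) by rewrite ler_wpM2r.
  by rewrite mulrCA divff ?gt_eqF // mulr1; lra.
have L0 : 0 < L by apply: lt_le_trans QL; rewrite mulr_gt0.
rewrite /U /V !lneE // -EFinB lee_fin -opprD lerN2 -mulrBr ler_pM2l //.
by rewrite -ln_div // ler_ln ?posrE ?divr_gt0 // ler_pdivlMr // mulrC.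
Qed.

Theorem theorem4p4 (R : realType) (n p r k m : nat)
    (pb : problem R n p r k m) (lambda : R)
    (Hpb : standing_assumptions pb lambda)
    (dOm : measure_display) (Om : measurableType dOm) (P : probability Om R)
    (Filt : R -> set (set Om)) (w : R -> Om -> 'cV[R]_r)
    (HFilt : filtration Filt) (Hw : brownian P Filt (pb_Sig pb) w)
    (Psistar Vstar : 'cV[R]_n -> R)
    (HPsi : linear_solution pb lambda Psistar)
    (HV : HJB_solution pb Vstar)
    (Hval : value_function P Filt pb w Vstar)
    (Hlog : forall x, Omega pb x ->
       ((Vstar x)%:E = - (lambda%:E * lne (Psistar x)%:E))%E)
    (psi : pol R n)
    (Hpsi : forall x, bndOmega pb x -> pev psi x = desirability pb lambda x)
    (d : nat) (z : sos_vars R n k m)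
    (Hz : sos_solution pb lambda psi d z)
    (eta : R) (Heta : eta = expR (- sup_norm pb Vstar / lambda)) :
  forall x, Omega pb x ->
    [/\ ((Vstar x)%:E <= V_u lambda z x)%E,
        (0 <= V_u lambda z x - (Vstar x)%:E)%E &
        (V_u lambda z x - (Vstar x)%:E <=
           - (lambda%:E * lne (1 - Num.min 1 (eps z / eta))%R%:E))%E].
Proof.
move=> x Ox; have [Hz' _] := Hz; have [VPsi _ _] := HPsi.
have [[cV _ _ _] _ _] := HV; have l0 := sa_lambda Hpb.
have Psi0 : 0 < Psistar x.
  (* otherwise the logarithm, hence Vstar x, would be infinite *)
  rewrite ltNge; apply/negP => Psi0.
  by have := Hlog x Ox; rewrite le0_lneNy ?lee_fin // gt0_muleNy ?lte_fin.
have VE : Vstar x = - (lambda * ln (Psistar x)).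
  by have := Hlog x Ox; rewrite lne_EFin // => -[].
have eta0 : 0 < eta by rewrite Heta expR_gt0.
have etaP : eta <= Psistar x.
  rewrite Heta -(lnK (x := Psistar x)) ?posrE // ler_expR ler_pdivrMr // mulrC.
  rewrite lerNl -VE; apply: le_trans (ler_norm _) _.
  exact: sup_norm_ge (sa_compact Hpb) cV Ox.
have [] := log_gap l0 eta0 etaP (Psi_l_le Hpb VPsi Hpsi Hz' Ox)
  (Psi_gap Hpb VPsi Hpsi Hz' Ox).
rewrite -Hlog // => le_VU gapVU; split => //.
by rewrite sube_ge0 // fin_numE.
Qed.
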